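(* Let $G$ be a countable discrete amenable group, $X=\mathbb{N}^G$, let $\{E_m\}_m$ be an exhausting sequence of $G$, and let $c\colon G\times\mathbb{N}\to[0,\infty)$ be a function such that (1) $\sum_{m\geq1}|E_{m+1}\setminus E_m|\sum_{g\in G\setminus E_m}C(g)<\infty$, where $C(g)=\sup_{n\in\mathbb{N}}c(g,n)$ for $g\neq1_G$; and (2) for all $M>0$ there exists $n_0\in\mathbb{N}$ such that $M\log(n)\leq c(1_G,n)$ for all $n\geq n_0$. Let $\phi\colon X\to\mathbb{R}$ be given by $$\phi(x)=-\sum_{g\in G}c(g,x(1_G))\,\mathbf{1}_{\{x(1_G)=x(g)\}}.$$ Then, for every $\beta>0$, the potential $\beta\phi$ is well-defined, has summable variation according to $\{E_m\}_m$, is exp-summable, and $\int\phi\,d\mu_\beta>-\infty$ for any Bowen-Gibbs measure $\mu_\beta$ for $\beta\phi$.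
   Context: $\mathbb{N}$ is the set of non-negative integers; $\mathcal{F}(G)$ is the set of nonempty finite subsets of $G$. $X=\mathbb{N}^G$ has the product topology and Borel $\sigma$-algebra. $x_D$ is the restriction of $x$ to $D\subseteq G$; for $w\in\mathbb{N}^F$, $[w]=\{x:x_F=w\}$. $G$ acts by $(g\cdot x)(h)=x(hg)$. For a potential $\psi\colon X\to\mathbb{R}$ and $F\in\mathcal F(G)$, $\psi_F(x)=\sum_{g\in F}\psi(g\cdot x)$. $F\in\mathcal F(G)$ is $(K,\delta)$-invariant if $|KF\,\triangle\,F|<\delta|F|$; $G$ is amenable if such $F$ exist for all $K\in\mathcal{F}(G),\delta>0$. An exhausting sequence is a sequence $\{E_m\}_{m\ge0}$ of finite subsets of $G$ with $E_0=\emptyset$, $E_1=\{1_G\}$, strictly increasing, with union $G$. With $\delta_E(\psi)=\sup\{|\psi(x)-\psi(y)|:x_E=y_E\}$, $\psi$ has summable variation according to $\{E_m\}_m$ if $\sum_{m\ge1}|E_{m+1}^{-1}\setminus E_m^{-1}|\,\delta_{E_m}(\psi)<\infty$. $\psi$ is exp-summable if $\sum_{a\in\mathbb{N}}\exp(\sup\{\psi(x):x(1_G)=a\})<\infty$. A Borel probability measure $\mu$ on $X$ is a Bowen-Gibbs measure for $\psi$ if there is $p\in\mathbb{R}$ such that for every $\epsilon>0$ there are $K\in\mathcal{F}(G)$ and $\delta>0$ with $\exp(-\epsilon|F|)\le\frac{\mu([x_F])}{\exp(\psi_F(x)-p|F|)}\le\exp(\epsilon|F|)$ for every $(K,\delta)$-invariant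 $F\in\mathcal{F}(G)$ and every $x\in X$. *)

(* Defs.v *)
From HB Require Import structures.
From mathcomp Require Import all_boot all_order all_algebra finmap.
From mathcomp Require Import all_classical all_reals all_analysis.
Import Order.TTheory GRing.Theory Num.Theory.
Import numFieldNormedType.Exports.

Set Implicit Arguments.
Unset Strict Implicit.
Unset Printing Implicit Defensive.

Local Open Scope classical_set_scope.
Local Open Scope ring_scope.

Section FiniteSubsets.
Variable G : groupType.
Implicit Types E F K : {fset G}.

Definition fset_mulg K F : {fset G} := [fset (k * f)%g | k in K, f in F]%fset.

Definition fset_invg E : {fset G} := [fset (g^-1)%g | g in E]%fset.

Definition fset_symdiff E F : {fset G} := ((E `\` F) `|` (F `\` E))%fset.

Definition Kdelta_invariant (R : realType) K (delta : R) F : Prop :=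
  #|` fset_symdiff (fset_mulg K F) F|%:R < delta * #|` F|%:R.

Definition amenable (R : realType) : Prop :=
  forall K (delta : R), K != fset0 -> 0 < delta ->
  exists2 F : {fset G}, F != fset0 & Kdelta_invariant K delta F.

Definition exhausting (E : nat -> {fset G}) : Prop :=
  [/\ E 0%N = fset0,
      E 1%N = [fset 1%g]%fset,
      forall m, (E m `<` E m.+1)%fset
    & forall g, exists m, g \in E m].

End FiniteSubsets.

(* [prod_topology] carries the product of the (discrete) topologies of [nat]. *)
Definition config (G : groupType) : Type := prod_topology (fun _ : G => nat).
HB.instance Definition _ (G : groupType) := Pointed.on (config G).
HB.instance Definition _ (G : groupType) := Nbhs.on (config G).
HB.instance Definition _ (G : groupType) := Topological.on (config G).

Definition borel_config (G : groupType) := g_sigma_algebraType (@open (config G)).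

Section Potentials.
Variables (G : groupType) (R : realType).
Implicit Types (x y : config G) (E F K : {fset G}) (psi : config G -> R).

Definition translate (g : G) x : config G := fun h => x (h * g)%g.

Definition agree_on F x y : Prop := forall g, g \in F -> y g = x g.

(* the cylinder [x_F] *)
Definition cylinder F x : set (config G) := [set y | agree_on F x y].

Definition birkhoff_sum psi F x : R := \sum_(g <- F) psi (translate g x).

Definition oscillation psi E : \bar R :=
  ereal_sup [set `|psi xy.1 - psi xy.2|%:E
            | xy in [set xy : config G * config G | agree_on E xy.1 xy.2]].

Definition summable_variation psi (E : nat -> {fset G}) : Prop :=
  (\sum_(1 <= m <oo)
     (#|` fset_invg (E m.+1) `\` fset_invg (E m)|%fset)%:R%:E
     * oscillation psi (E m) < +oo)%E.

Definition exp_summable psi : Prop :=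
  (\sum_(0 <= a <oo)
     expeR (ereal_sup [set (psi x)%:E | x in [set x : config G | x 1%g = a]])
   < +oo)%E.

Definition bowen_gibbs psi (mu : probability (borel_config G) R) : Prop :=
  exists p : R, forall eps : R, 0 < eps ->
  exists K : {fset G}, exists delta : R,
  [/\ K != fset0, 0 < delta &
    forall F, F != fset0 -> Kdelta_invariant K delta F ->
    forall x : config G,
      expR (- eps * #|` F|%:R)
      <= fine (mu (cylinder F x))
         / expR (birkhoff_sum psi F x - p * #|` F|%:R)
      <= expR (eps * #|` F|%:R)].

Implicit Type c : G -> nat -> R.

(* May be [+oo]. The statement only uses it at [g != 1]. *)
Definition sup_coef c (g : G) : \bar R := ereal_sup [set (c g n)%:E | n in setT].

(* The defining series of the potential, summed in [\bar R]: it has nonnegative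
   terms up to the global sign, so it is well-defined in R iff it is finite. *)
Definition phi_series c x : \bar R :=
  (- \esum_(g in [set: G]) (c g (x 1%g) * (x 1%g == x g)%:R)%:E)%E.

Definition phi c x : R := fine (phi_series c x).

End Potentials.

(* Main.v *)
(** Write [X_g = x g]. Isolating the [g = 1] term gives [phi x = - (c 1 X_1 + B)]
    with [B] between 0 and the sum of the [C g], [g <> 1], which is finite by
    the [m = 1] term of the first hypothesis. Two points agreeing on [E m] have
    the same terms for [g] in [E m], so the oscillation of [phi] on [E m] is at
    most the tail of [sum C] off [E m]. The growth condition with
    [M = 2 / gamma] gives [exp (- gamma c 1 a) = O(1 / a^2)] for every
    [gamma > 0], whence exp-summability.

    For the integral, a single [(K, delta)]-invariant [F] is used; right
    translation preserves invariance, so one may take [1] in [F]. The Gibbs upper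
    bound on the cylinder [x_F] is a constant times the product over [g] in [F]
    of [exp (- beta c 1 X_g)]. Summing over the coordinates in [F] other than
    [1], one at a time, leaves [mu (X_1 = a) <= K exp (- beta c 1 a)], and
    [sum_a c 1 a exp (- beta c 1 a)] converges. *)
Require Import Defs.
From HB Require Import structures.
From mathcomp Require Import all_boot all_order all_algebra finmap.
From mathcomp Require Import all_classical all_reals all_analysis.
From mathcomp Require Import zify ring lra.
Import Order.TTheory GRing.Theory Num.Theory.
Import numFieldNormedType.Exports.

Local Open Scope classical_set_scope.
Local Open Scope ring_scope.

(** * Summability from superlogarithmic growth *)

Lemma nneseries_le_bound (R : realType) (u : nat -> R) (B : R) :
  (forall n, 0 <= u n) -> (forall n, \sum_(0 <= i < n) u i <= B) ->
  (\sum_(0 <= i <oo) (u i)%:E <= B%:E)%E.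
Proof.
move=> u0 uB; apply: lime_le.
  by apply: is_cvg_nneseries => n _ _; rewrite lee_fin.
by apply: nearW => n; rewrite sumEFin lee_fin.
Qed.

(** The series telescopes: [1/(t+1)^2 <= 1/t - 1/(t+1)], so the first [m+1] terms sum to at most
    [2 - 1/(m+1)]. *)
Lemma nneseries_inv_sqr (R : realType) :
  (\sum_(0 <= n <oo) ((n.+1%:R ^+ 2)^-1 : R)%:E <= 2%:E)%E.
Proof.
apply: nneseries_le_bound => [n|n]; first by rewrite invr_ge0 sqr_ge0.
suff H m : \sum_(0 <= i < m.+1) ((i.+1%:R : R) ^+ 2)^-1 <= 2 - m.+1%:R^-1.
  case: n => [|n]; first by rewrite big_nil.
  by apply: le_trans (H n) _; rewrite lerBlDr lerDl invr_ge0.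
elim: m => [|m IHm]; first by rewrite big_nat1 expr1n invr1; lra.
rewrite big_nat_recr//=.
have m0 : 0 < m.+1%:R :> R by rewrite ltr0n.
rewrite -(natr1 m.+1); set t := m.+1%:R in IHm m0 *.
have t1 : 0 < t + 1 by lra.
suff le_inv : ((t + 1) ^+ 2)^-1 <= t^-1 - (t + 1)^-1.
  by apply: le_trans (lerD IHm le_inv) _; rewrite addrA subrK.
have -> : t^-1 - (t + 1)^-1 = (t * (t + 1))^-1.
  by field; rewrite !gt_eqF.
rewrite lef_pV2 ?posrE ?exprn_gt0 ?mulr_gt0// expr2 ler_pM2r//. lra.
Qed.

Lemma expRN_superlog_le (R : realType) (f : nat -> R) (gamma : R) :
  0 < gamma -> (forall n, 0 <= f n) ->
  (forall M : R, 0 < M -> exists n0 : nat, forall n : nat, (n0 <= n)%N ->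
    M * ln n%:R <= f n) ->
  exists C : R, forall n, expR (- (gamma * f n)) <= C * (n.+1%:R ^+ 2)^-1.
Proof.
move=> gamma0 f0 fgrowth.
have [n0 Hn0] := fgrowth (2 / gamma) (divr_gt0 (ltr0n _ 2) gamma0).
(* The constant serves twice: for [n <= n0+1] the exponential is at most 1 and
   [(n+1)^2 <= (n0+2)^2]; for larger [n] the exponential is at most [1/n^2] and the constant absorbs
   the ratio [(n+1)^2 / n^2]. *)
exists (n0.+2%:R ^+ 2) => n.
rewrite ler_pdivlMr ?exprn_gt0 ?ltr0n//.
have [nn0|n0n] := leqP n n0.+1.
  rewrite -[leRHS]mul1r ler_pM ?expR_ge0 ?sqr_ge0//.
    by rewrite expR_le1 oppr_le0 mulr_ge0// ltW.
  by rewrite ler_sqr ?nnegrE ?ler0n// ler_nat ltnS.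
have n_gt0 : 0 < n%:R :> R by rewrite ltr0n (leq_trans _ n0n).
have le_exp : expR (- (gamma * f n)) <= (n%:R ^+ 2)^-1.
  rewrite expRN lef_pV2 ?posrE ?expR_gt0 ?exprn_gt0//.
  rewrite -[leLHS]lnK ?posrE ?exprn_gt0// ler_expR lnXn// -[ln _ *+ 2]mulr_natl.
  have := Hn0 n (ltnW (ltnW n0n)).
  by rewrite mulrAC ler_pdivrMr// mulrC [f n * _]mulrC.
apply: le_trans (ler_wpM2r (sqr_ge0 _) le_exp) _.
rewrite ler_pdivrMl ?exprn_gt0// -exprMn ler_sqr ?nnegrE//.
rewrite -natrM ler_nat; nia.
Qed.

(* Unlike [ge0_le_integral], this applies to [phi] without a proof that [phi]
   is measurable: the integral of a nonnegative function is the supremum over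
   the simple functions below it. *)
Lemma ge0_integral_mono (d : measure_display) (T : measurableType d)
    (R : realType) (mu : {measure set T -> \bar R}) (f g : T -> \bar R) :
  (forall x, 0 <= f x)%E -> (forall x, f x <= g x)%E ->
  (\int[mu]_x f x <= \int[mu]_x g x)%E.
Proof.
move=> f0 fg; have g0 x : (0 <= g x)%E := le_trans (f0 x) (fg x).
rewrite !ge0_integralTE//; apply: ereal_sup_le => _ [h hf <-].
by exists h => // x; exact: le_trans (hf x) (fg x).
Qed.

(** * Cylinders, and summing out coordinates *)

Section Cylinders.
Context (G : groupType) (R : realType).
Implicit Types (D : {fset G}) (x : config G).

Lemma open_coord (g : G) (A : set nat) : open [set x : config G | A (x g)].
Proof.
have open_preimage :=
  @open_comp (prod_topology (fun _ : G => nat)) nat (@proj G (fun=> nat) g) A.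
apply: open_preimage => [x _|].
  exact: proj_continuous.
exact: discrete_open.
Qed.

Lemma measurable_coord (g : G) (A : set nat) :
  measurable ([set x | A (x g)] : set (borel_config G)).
Proof. by apply: sub_sigma_algebra; exact: open_coord. Qed.

Lemma cylinderU1 h D x :
  cylinder (h |` D)%fset x = [set y | y h = x h] `&` cylinder D x.
Proof.
apply/seteqP; split => y /=.
  by move=> xy; split => [|g gD]; apply: xy; rewrite !inE ?eqxx ?gD ?orbT.
by case=> yh xy g; rewrite !inE => /predU1P[->//|/xy].
Qed.

Lemma measurable_cylinder D x :
  measurable (cylinder D x : set (borel_config G)).
Proof.
elim/fset1U_rect: D => [|h D hD IHD].
  by rewrite (_ : cylinder _ _ = setT)//; apply/seteqP; split.
rewrite cylinderU1; apply: measurableI => //.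
exact: (measurable_coord h (fun a => a = x h)).
Qed.

Definition set_coord x (h : G) (b : nat) : config G :=
  fun g => if g == h then b else x g.

Lemma cylinder_bigcup h D x : h \notin D ->
  cylinder D x = \bigcup_b cylinder (h |` D)%fset (set_coord x h b).
Proof.
move=> hD; have set_coordD b g : g \in D -> set_coord x h b g = x g.
  by move=> gD; rewrite /set_coord; case: eqP gD hD => // -> ->.
apply/seteqP; split => y /=.
  move=> xy; exists (y h) => // g; rewrite !inE => /predU1P[->|gD].
    by rewrite /set_coord eqxx.
  by rewrite set_coordD// xy.
by move=> [b _ +] g gD => /(_ g); rewrite !inE gD orbT set_coordD//; exact.
Qed.

Variables (mu : probability (borel_config G) R) (q : nat -> R).
Hypothesis q_ge0 : forall a, 0 <= q a.
Hypothesis q_sum : (\sum_(0 <= a <oo) (q a)%:E < +oo)%E.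

(** Domination by a product weight, with one constant for all patterns on [D]; this form survives
    the removal of a coordinate. *)
Definition cylinder_bound D (K : R) := 0 <= K /\
  forall x, (mu (cylinder D x) <= (K * \prod_(g <- D) q (x g))%:E)%E.

(** The cylinder over [D] is the disjoint union, over the value [b] at [h], of cylinders over [D]
    and [h]. Countable additivity turns the factor [q b] into the total mass of [q], which goes into
    the constant. *)
Lemma cylinder_boundU1 h D : h \notin D ->
  (exists K, cylinder_bound (h |` D)%fset K) ->
  exists K, cylinder_bound D K.
Proof.
move=> hD [K [K0 HK]].
have Zge0 : (0 <= \sum_(0 <= a <oo) (q a)%:E)%E.
  by apply: nneseries_ge0 => n _ _; rewrite lee_fin.
have Zfin : (\sum_(0 <= a <oo) (q a)%:E)%E \is a fin_num by rewrite ge0_fin_numE.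
exists (K * fine (\sum_(0 <= a <oo) (q a)%:E)%E).
split=> [|x]; first by rewrite mulr_ge0// fine_ge0.
rewrite (cylinder_bigcup _ _ _ hD) measure_semi_bigcup.
- apply: (@le_trans _ _ (\sum_(0 <= b <oo)
      ((K * \prod_(g <- D) q (x g))%:E * (q b)%:E)))%E.
    apply: lee_nneseries => // b _; apply: le_trans (HK _) _.
    rewrite big_fsetU1//= /set_coord eqxx -EFinM lee_fin -mulrA [q b * _]mulrC.
    rewrite (eq_big_seq (fun g => q (x g)))// => g gD.
    by case: eqP gD hD => // -> ->.
  rewrite nneseriesZl; last by move=> *; rewrite lee_fin.
  rewrite -[X in (_ * X)%E]fineK// -EFinM lee_fin.
  by rewrite mulrAC.
- by move=> b; exact: measurable_cylinder.
- apply/trivIsetP => i j _ _ ij; rewrite -subset0 => y /= [].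
  move=> /(_ h (fset1U1 _ _)) yi /(_ h (fset1U1 _ _)).
  by rewrite yi /set_coord eqxx => /eqP; rewrite (negbTE ij).
- rewrite -cylinder_bigcup//; exact: measurable_cylinder.
Qed.

Lemma cylinder_bound_sub D D' : (D `<=` D')%fset ->
  (exists K, cylinder_bound D' K) -> exists K, cylinder_bound D K.
Proof.
(* Writing the larger set as the union of [D] and [D'] lets the induction drop the elements of [D']
   one by one while keeping [D]. *)
move=> /fsetUidPr <-; elim/fset1U_rect: D' => [|h D' hD' IH].
  by rewrite fsetU0.
rewrite fsetUCA => HK; apply: IH.
have [hD|/cylinder_boundU1] := boolP (h \in D `|` D')%fset; last exact.
by rewrite mem_fset1U in HK.
Qed.

End Cylinders.

(** * Right translation of invariant sets *)

Section Translation.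
Context (G : groupType) (R : realType).
Implicit Types K F : {fset G}.

Definition fset_mulgr F (t : G) : {fset G} := [fset (g * t)%g | g in F]%fset.

Lemma mem_fset_mulgr F t g : (g \in fset_mulgr F t) = ((g * t^-1)%g \in F).
Proof.
apply/imfsetP/idP => /= [[f fF ->]|gF]; first by rewrite mulgK.
by exists (g * t^-1)%g => //; rewrite mulgVK.
Qed.

Lemma card_fset_mulgr F t : #|` fset_mulgr F t| = #|` F|.
Proof. by rewrite card_imfset//=; exact: mulIg. Qed.

(** Left multiplication by [K] commutes with right translation, so the symmetric difference is
    merely translated and all cardinalities persist. *)
Lemma Kdelta_invariant_mulgr K (delta : R) F t :
  Kdelta_invariant K delta F -> Kdelta_invariant K delta (fset_mulgr F t).
Proof.
rewrite /Kdelta_invariant card_fset_mulgr.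
suff -> : fset_symdiff (fset_mulg K (fset_mulgr F t)) (fset_mulgr F t)
    = fset_mulgr (fset_symdiff (fset_mulg K F) F) t.
  by rewrite card_fset_mulgr.
have mulE : fset_mulg K (fset_mulgr F t) = fset_mulgr (fset_mulg K F) t.
  apply/fsetP => g; rewrite mem_fset_mulgr; apply/imfset2P/imfset2P => /=.
    move=> [k kK [f]]; rewrite mem_fset_mulgr => fF ->.
    by exists k => //; exists (f * t^-1)%g => //; rewrite mulgA.
  move=> [k kK [f fF gE]]; exists k => //; exists (f * t)%g.
    by rewrite mem_fset_mulgr mulgK.
  by rewrite mulgA -gE mulgVK.
by apply/fsetP => g; rewrite mulE mem_fset_mulgr !inE !mem_fset_mulgr.
Qed.

Lemma amenable_invariant1 K (delta : R) :
  amenable G R -> K != fset0 -> 0 < delta ->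
  exists2 F : {fset G}, 1%g \in F & Kdelta_invariant K delta F.
Proof.
move=> amen K0 delta0; have [F /fset0Pn[f fF] FK] := amen K delta K0 delta0.
exists (fset_mulgr F f^-1); last exact: Kdelta_invariant_mulgr.
by rewrite mem_fset_mulgr invgK mul1g.
Qed.

End Translation.

(** * The marginal of a Gibbs measure at the identity *)

Lemma bowen_gibbs_marginal (G : groupType) (R : realType) (psi : config G -> R)
    (f : nat -> R) (mu : probability (borel_config G) R) :
  amenable G R -> (forall x, psi x <= - f (x 1%g)) ->
  (\sum_(0 <= a <oo) (expR (- f a))%:E < +oo)%E ->
  bowen_gibbs psi mu ->
  exists2 K : R, 0 <= K & forall a,
    (mu [set x | x 1%g = a] <= (K * expR (- f a))%:E)%E.
Proof.
move=> amen psi_le fsum [p /(_ 1 ltr01)[K [delta [K0 delta0 gibbs]]]].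
have [F F1 FK] := amenable_invariant1 _ _ K delta amen K0 delta0.
have F0 : F != fset0 by apply/fset0Pn; exists 1%g.
have q_ge0 a : 0 <= expR (- f a) by exact: expR_ge0.
(* The Gibbs upper bound with [eps = 1] contributes [exp |F|] and the pressure [exp (- p |F|)],
   whence this constant. *)
have bound_F :
    cylinder_bound _ _ mu (fun a => expR (- f a)) F
      (expR ((1 - p) * #|` F|%:R)).
  split=> [|x]; first exact: expR_ge0.
  have /andP[_] := gibbs F F0 FK x.
  rewrite ler_pdivrMr ?expR_gt0// => mu_le.
  rewrite -[leLHS]fineK; last first.
    by rewrite fin_num_measure//; exact: measurable_cylinder.
  rewrite lee_fin (le_trans mu_le)//.
  rewrite -expR_sum -!expRD ler_expR mulrBl !mul1r sumrN.
  (* At the identity [translate g x] has the value [x g], so each summand of the Birkhoff sum yields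
     the factor of one coordinate. *)
  suff : birkhoff_sum psi F x <= - \sum_(g <- F) f (x g) by lra.
  rewrite -sumrN; apply: ler_sum => g _.
  by apply: le_trans (psi_le _) _; rewrite /translate mul1g.
have F1sub : ([fset 1%g] `<=` F)%fset by rewrite fsub1set.
have [K1 [K1_ge0 HK1]] := cylinder_bound_sub _ _ mu _ q_ge0 fsum _ _ F1sub
  (ex_intro _ _ bound_F).
exists K1 => // a; have := HK1 (fun=> a); rewrite big_seq_fset1.
rewrite (_ : cylinder _ _ = [set x | x 1%g = a])//.
apply/seteqP; split => y /= => [|ya g]; first by apply; rewrite inE.
by rewrite inE => /eqP->.
Qed.

(** The integrand is constant on each of the countably many sets where the coordinate at [g] is
    fixed, and these partition the space. *)
Lemma integral_coord_le (G : groupType) (R : realType)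
    (mu : probability (borel_config G) R) (g : G) (h u : nat -> R) :
  (forall a, 0 <= h a) ->
  (forall a, (mu [set x | x g = a] <= (u a)%:E)%E) ->
  (\int[mu]_x (h (x g))%:E <= \sum_(0 <= a <oo) (h a * u a)%:E)%E.
Proof.
move=> h0 mu_le.
have setTE : setT = \bigcup_a [set x : borel_config G | x g = a].
  by apply/seteqP; split => x //= _; exists (x g).
rewrite setTE ge0_integral_bigcup.
- apply: lee_nneseries => [a _ _|a _].
    by apply: integral_ge0 => x _; rewrite lee_fin.
  rewrite (eq_integral (cst (h a)%:E)); last by move=> x; rewrite inE /= => ->.
  rewrite integral_cst; last exact: (measurable_coord G g (fun b => b = a)).
  by rewrite EFinM; apply: lee_wpmul2l; [rewrite lee_fin; exact: h0|exact: mu_le].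
- by move=> a; exact: (measurable_coord G g (fun b => b = a)).
- rewrite -setTE => _ Y _; rewrite setTI.
  exact: (measurable_coord G g (fun b => Y (h b)%:E)).
- by move=> x _; rewrite lee_fin.
- by apply/trivIsetP => i j _ _ /eqP ij; rewrite -subset0 => y /= [-> /ij].
Qed.

(** * The potential and its tails *)

Section Potential.
Context (R : realType) (G : groupType) (c : G -> nat -> R).
Hypothesis c_ge0 : forall g n, 0 <= c g n.
Implicit Types (D : {fset G}) (x y : config G).

(** At [D = E m] this is the inner sum of the summability hypothesis. *)
Definition coef_tail D : \bar R :=
  \esum_(g in [set g | g \notin D]) sup_coef c g.

Definition phi_term x (g : G) : \bar R :=
  (c g (x 1%g) * (x 1%g == x g)%:R)%:E.

Definition phi_tail D x : \bar R :=
  \esum_(g in [set g | g \notin D]) phi_term x g.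

Lemma phi_term_ge0 x g : (0 <= phi_term x g)%E.
Proof. by rewrite lee_fin mulr_ge0. Qed.

Lemma phi_term_le_sup x g : (phi_term x g <= sup_coef c g)%E.
Proof.
apply: le_trans (ereal_sup_ubound _); last by exists (x 1%g).
by rewrite lee_fin ler_piMr// lern1 leq_b1.
Qed.

Lemma phi_tail_ge0 D x : (0 <= phi_tail D x)%E.
Proof. by apply: esum_ge0 => g _; exact: phi_term_ge0. Qed.

Lemma phi_tail_le D x : (phi_tail D x <= coef_tail D)%E.
Proof. by apply: le_esum => g _; exact: phi_term_le_sup. Qed.

Lemma phi_seriesE D x :
  phi_series c x =
  (- (\esum_(g in [set g | g \in D]) phi_term x g + phi_tail D x))%E.
Proof.
rewrite /phi_series (esumID [set g | g \in D]); last first.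
  by move=> g _; exact: phi_term_ge0.
rewrite !setTI; congr (- (_ + esum _ _))%E.
by apply/seteqP; split => g /= /negP.
Qed.

Lemma phi_series1E x :
  phi_series c x = (- ((c 1%g (x 1%g))%:E + phi_tail [fset 1%g]%fset x))%E.
Proof.
rewrite (phi_seriesE [fset 1%g]%fset); congr (- (_ + _))%E.
rewrite (_ : [set g | g \in _] = [set 1%g]); last first.
  by apply/seteqP; split => g /=; rewrite inE => /eqP.
by rewrite esum_set1 ?phi_term_ge0// /phi_term eqxx mulr1.
Qed.

Hypothesis tail1_fin : (coef_tail [fset 1%g]%fset < +oo)%E.

Lemma coef_tail1_fin_num : coef_tail [fset 1%g]%fset \is a fin_num.
Proof.
rewrite ge0_fin_numE//.
exact: le_trans (phi_tail_ge0 [fset 1%g]%fset (fun=> 0%N)) (phi_tail_le _ _).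
Qed.

Lemma phi_tail1_fin_num x : phi_tail [fset 1%g]%fset x \is a fin_num.
Proof.
by rewrite ge0_fin_numE ?phi_tail_ge0// (le_lt_trans (phi_tail_le _ _)).
Qed.

Lemma phi_series_fin_num x : phi_series c x \is a fin_num.
Proof. by rewrite phi_series1E fin_numN fin_numD phi_tail1_fin_num. Qed.

Lemma phi_le x : phi c x <= - c 1%g (x 1%g).
Proof.
rewrite -lee_fin /phi fineK ?phi_series_fin_num// phi_series1E EFinN leeN2.
by rewrite leeDl// phi_tail_ge0.
Qed.

Lemma phi_ge x :
  - (c 1%g (x 1%g) + fine (coef_tail [fset 1%g]%fset)) <= phi c x.
Proof.
rewrite -lee_fin /phi fineK ?phi_series_fin_num// phi_series1E EFinN leeN2.
by rewrite EFinD fineK ?coef_tail1_fin_num// leeD2l// phi_tail_le.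
Qed.

(** Since [1] is in [D], the terms indexed by [D] coincide and cancel. What remains is a difference
    of two tails in [[0, coef_tail D]], so no factor 2 appears. *)
Lemma phi_dist_le D x y : 1%g \in D -> agree_on D x y ->
  (`|phi c x - phi c y|%:E <= coef_tail D)%E.
Proof.
move=> D1 xy.
have headE : \esum_(g in [set g | g \in D]) phi_term y g =
             \esum_(g in [set g | g \in D]) phi_term x g.
  by apply: eq_esum => g gD; rewrite /phi_term !xy.
have := phi_seriesE D y; have := phi_seriesE D x; rewrite headE.
set A := esum _ _.
have A0 : (0 <= A)%E by apply: esum_ge0 => g _; exact: phi_term_ge0.
have := phi_series_fin_num x; have := phi_series_fin_num y.
rewrite /phi => yfin xfin xE yE; move: yfin xfin; rewrite xE yE.
have := phi_tail_le D x; have := phi_tail_le D y.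
have := phi_tail_ge0 D x; have := phi_tail_ge0 D y.
(* Nonnegativity and finiteness of the series rule out every infinite case. *)
move: (phi_tail D x) (phi_tail D y) A A0 {headE xE yE}
  => [bx| |] [by_| |] [a| |] //=.
move=> _; rewrite !lee_fin => by0 bx0 lty ltx _ _.
have [le_b|lt_b] := leP bx by_.
- apply: le_trans lty; rewrite lee_fin.
  by rewrite opprK addrC opprD addrA subrK ger0_norm ?subr_ge0//; lra.
- apply: le_trans ltx; rewrite lee_fin.
  by rewrite ler_norml; lra.
Qed.

End Potential.

(** Reconciles the weights: summable variation counts inverses, the hypothesis on [c] does not. *)
Lemma card_fset_invgD (G : groupType) (A B : {fset G}) :
  #|` fset_invg A `\` fset_invg B|%fset = #|` A `\` B|%fset.
Proof.
suff -> : (fset_invg A `\` fset_invg B)%fset = fset_invg (A `\` B)%fset.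
  by rewrite card_imfset//=; exact: invg_inj.
have mem_fset_invg C g : (g \in fset_invg C) = ((g^-1)%g \in C).
  apply/imfsetP/idP => /= [[f fC ->]|gC]; first by rewrite invgK.
  by exists (g^-1)%g => //; rewrite invgK.
by apply/fsetP => g; rewrite mem_fset_invg !inE !mem_fset_invg.
Qed.

(** * Finiteness, both summability claims and the integral bound *)

Theorem lemma6p2 (R : realType) (G : groupType)
  (G_countable : countable [set: G])
  (G_amenable : amenable G R)
  (E : nat -> {fset G}) (E_exhausting : exhausting E)
  (c : G -> nat -> R) (c_ge0 : forall g n, 0 <= c g n)
  (c_summable :
    (\sum_(1 <= m <oo)
       (#|` E m.+1 `\` E m|%fset)%:R%:E
       * (\esum_(g in [set g | g \notin E m]) sup_coef c g) < +oo)%E)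
  (c_growth : forall M : R, 0 < M ->
    exists n0 : nat, forall n : nat, (n0 <= n)%N ->
      M * ln n%:R <= c 1%g n) :
  forall beta : R, 0 < beta ->
  let psi : config G -> R := fun x => beta * phi c x in
  [/\ forall x : config G, phi_series c x \is a fin_num,
      summable_variation psi E,
      exp_summable psi
    & forall mu : probability (borel_config G) R, bowen_gibbs psi mu ->
      (-oo < \int[mu]_x (phi c x)%:E)%E].
Proof.
move=> beta beta0 psi.
case: E_exhausting => _ E1 Eincr _.
have tail_ge0 D : (0 <= coef_tail R G c D)%E.
  exact: le_trans (phi_tail_ge0 _ _ _ c_ge0 D (fun=> 0%N))
                  (phi_tail_le _ _ _ c_ge0 _ _).
have tail1_fin : (coef_tail R G c [fset 1%g]%fset < +oo)%E.
  (* The [m = 1] term alone dominates this tail, because its weight is at least 1: [E 2] strictly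
     contains [E 1]. *)
  apply: le_lt_trans c_summable; apply: le_trans (nneseries_lim_ge 2 _); last first.
    by move=> n _ _; apply: mule_ge0; [rewrite lee_fin|exact: tail_ge0].
  rewrite big_nat1 E1; apply: lee_pemull; first exact: tail_ge0.
  rewrite lee_fin ler1n cardfs_gt0 -E1 fsetD_eq0.
  by have := Eincr 1%N; rewrite fproperE => /andP[].
have phi_le0 := phi_le _ _ _ c_ge0 tail1_fin.
have psi_le x : psi x <= - (beta * c 1%g (x 1%g)).
  by rewrite /psi -mulrN ler_pM2l.
have expR_sum_fin gamma : 0 < gamma ->
    (\sum_(0 <= a <oo) (expR (- (gamma * c 1%g a)))%:E < +oo)%E.
  move=> gamma0.
  have [C HC] := expRN_superlog_le _ _ _ gamma0 (c_ge0 1%g) c_growth.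
  apply: (@le_lt_trans _ _
      (\sum_(0 <= a <oo) (C%:E * ((a.+1%:R ^+ 2)^-1)%:E))%E).
    apply: lee_nneseries => [a _ _|a _]; first by rewrite lee_fin expR_ge0.
    by rewrite -EFinM lee_fin.
  have C0 : 0 <= C.
    by have := HC 0%N; rewrite expr1n invr1 mulr1; apply: le_trans;
      exact: expR_ge0.
  rewrite nneseriesZl; last by move=> a _; rewrite lee_fin invr_ge0 sqr_ge0.
  apply: le_lt_trans (lee_wpmul2l _ (nneseries_inv_sqr R)) _.
    by rewrite lee_fin.
  by rewrite -EFinM ltry.
split.
- exact: phi_series_fin_num.
- have osc_ge0 D : (0 <= oscillation psi D)%E.
    apply: ereal_sup_ubound; exists ((fun=> 0%N), (fun=> 0%N)) => //=.
    by rewrite subrr normr0.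
  (* The index is shifted because the identity lies in [E m] only from [m = 1] on. *)
  have osc_le m :
      (oscillation psi (E m.+1) <= beta%:E * coef_tail R G c (E m.+1))%E.
    apply: ge_ereal_sup => _ [[x y] /= xy <-].
    have E1m : 1%g \in E m.+1.
      elim: m {xy} => [|m IHm]; first by rewrite E1 inE.
      by have /fproper_sub/fsubsetP := Eincr m.+1; apply.
    rewrite /psi -mulrBr normrM (gtr0_norm beta0) EFinM lee_pmul2l ?lte_fin//.
    exact: phi_dist_le.
  rewrite /summable_variation.
  rewrite -(@nneseries_addn _ _ 1); last by move=> m; rewrite mule_ge0 ?lee_fin.
  apply: (@le_lt_trans _ _ (beta%:E * (\sum_(1 <= m <oo)
     ((#|` E m.+1 `\` E m|%fset)%:R%:E * coef_tail R G c (E m))))%E).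
    rewrite -(@nneseries_addn _ _ 1); last by move=> m; rewrite mule_ge0 ?lee_fin.
    rewrite -nneseriesZl; last by move=> m _; rewrite mule_ge0 ?lee_fin.
    apply: lee_nneseries => [m _ _|m _]; first by rewrite mule_ge0 ?lee_fin.
    rewrite card_fset_invgD muleCA addn1.
    by apply: lee_wpmul2l; rewrite ?lee_fin.
  by rewrite lte_mul_pinfty ?lee_fin ?(ltW beta0).
- rewrite /exp_summable; apply: le_lt_trans (expR_sum_fin beta beta0).
  apply: lee_nneseries => [a _ _|a _]; first exact: expeR_ge0.
  rewrite -[leRHS]/(expeR (- (beta * c 1%g a))%:E) lee_expeR.
  by apply: ge_ereal_sup => _ [x /= <- <-]; rewrite lee_fin.
- move=> mu psi_gibbs.
  have [K K0 mu_le] := bowen_gibbs_marginal _ _ _ (fun a => beta * c 1%g a)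
    _ G_amenable psi_le (expR_sum_fin _ beta0) psi_gibbs.
  (* [S] bounds what the indices other than the identity contribute to [- phi]. *)
  set S := fine (coef_tail R G c [fset 1%g]%fset).
  have S0 : 0 <= S by exact: fine_ge0.
  have phi_npos x : phi c x <= 0 by rewrite (le_trans (phi_le0 x))// oppr_le0.
  (* The positive part has nonnegative integral, so it is enough that the negative part has finite
     integral. *)
  rewrite integralE (@lt_le_trans _ _
      (0 - \int[mu]_x ((fun x => (phi c x)%:E)^\- x))%E)//; last first.
    by rewrite leeD2r// integral_ge0.
  rewrite sub0e lteNr /=.
  apply: (@le_lt_trans _ _ (\int[mu]_x (c 1%g (x 1%g) + S)%:E)%E).
    apply: ge0_integral_mono => x; first exact: funeneg_ge0.
    rewrite funenegE -EFinN -EFin_max lee_fin ge_max addr_ge0// andbT.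
    by rewrite lerNl; exact: phi_ge.
  apply: le_lt_trans
    (integral_coord_le _ _ _ _ (fun a => c 1%g a + S) _ _ mu_le) _.
    by move=> a; rewrite addr_ge0.
  (* Half of the decay [exp (- beta t)] absorbs the factor [t + S], at the cost [2 / beta + S]; the
     other half keeps the series convergent. [K] comes from the marginal bound. *)
  pose B := (2 / beta + S) * K.
  have B0 : 0 <= B by rewrite mulr_ge0// addr_ge0// divr_ge0// ltW.
  apply: (@le_lt_trans _ _
      (\sum_(0 <= a <oo) (B%:E * (expR (- (beta / 2 * c 1%g a)))%:E))%E).
    apply: lee_nneseries => [a _ _|a _].
      by rewrite lee_fin mulr_ge0 ?addr_ge0 ?mulr_ge0 ?expR_ge0.
    rewrite -EFinM lee_fin.
    (* [t e^{-beta t} <= (2/beta) e^{-beta t/2}], since [s <= e^s] at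
       [s = beta t/2]. *)
    set t := c 1%g a; set e := expR (- (beta / 2 * t)).
    have -> : expR (- (beta * t)) = e * e by rewrite -expRD; congr expR; field.
    rewrite (_ : (t + S) * (K * (e * e)) = K * ((t + S) * e * e)); last by ring.
    rewrite (_ : B * e = K * ((2 / beta + S) * e)); last by rewrite /B; ring.
    have e0 : 0 < e by exact: expR_gt0.
    have e1 : e <= 1.
      by rewrite expR_le1 oppr_le0 mulr_ge0 ?c_ge0// divr_ge0// ltW.
    rewrite ler_wpM2l// ler_pM2r// mulrDl lerD//; last by rewrite ler_piMr.
    rewrite /e expRN ler_pdivrMr ?expR_gt0//.
    rewrite -[leLHS](_ : 2 / beta * (beta / 2 * t) = t); last first.
      by field; rewrite gt_eqF.
    rewrite ler_wpM2l//; first by rewrite divr_ge0// ltW.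
        by apply: le_trans (expR_ge1Dx _); rewrite lerDr.
  rewrite nneseriesZl; last by move=> a _; rewrite lee_fin expR_ge0.
  by rewrite lte_mul_pinfty ?lee_fin// expR_sum_fin// divr_gt0.
Qed.
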